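(* Let $M$ be a flat Klein bottle. Then for every point $P\in M$ the wave front $W_t(P)$ becomes dense on $M$. That is, for every $P\in M$ and every $r>0$ there is a time $\tau(P,r)$ such that for all $t>\tau(P,r)$ and all $Q\in M$ one has $W_t(P)\cap B_r(Q)\neq\emptyset$.
   Context: A flat Klein bottle is a Klein bottle equipped with a flat Riemannian metric; up to isometry it is a quotient $\mathbb{R}^2/\Gamma$ of the Euclidean plane with the induced metric, where $\Gamma$ is the group of isometries generated by $(x,y)\mapsto(x+a,-y)$ and $(x,y)\mapsto(x,y+b)$ for some $a,b>0$ (so it has a flat 2-torus as a 2:1 cover). For a point $P$ of a complete Riemannian manifold $M$ and $t>0$, the wave front of $P$ at time $t$ is $W_t(P)=\exp_P(S_t)$, where $\exp_P:T_PM\to M$ is the Riemannian exponential map and $S_t=\{v\in T_PM:\ |v|=t\}$. For $M=\mathbb{R}^2/\Gamma$ this is the image under the quotient map $\mathbb{R}^2\to M$ of the Euclidean circle of radius $t$ centered at a lift of $P$. For $Q\in M$ and $r>0$, $B_r(Q)$ is the open ball of points of $M$ that can be joined to $Q$ by a geodesic of length smaller than $r$. The wave front $W_t(P)$ is said to become dense on $M$ if for every open ball $B_r(Q)$ with $r>0$ there is a time $\tau(P,r)$ (depending on $P$ and $r$ but not on $Q$) such that $W_t(P)\cap B_r(Q)\ne\emptyset$ for all $t>\tau(P,r)$; equivalently, for every $\epsilon>0$ the $\epsilon$-neighborhood of $W_t(P)$ is all of $M$ for all sufficiently large $t$. *)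

(* Defs.v *)
From mathcomp Require Import all_boot all_order all_algebra.
From mathcomp Require Import generic_quotient.
From mathcomp Require Import boolp classical_sets reals.
From mathcomp Require Import ring lra.

Set Implicit Arguments.
Unset Strict Implicit.
Unset Printing Implicit Defensive.

Import Order.TTheory GRing.Theory Num.Theory.
Local Open Scope classical_set_scope.
Local Open Scope ring_scope.
Local Open Scope quotient_scope.

(* The subgroup generated by S in the group of bijections of T (when the
   elements of S are bijections). *)
Inductive generated (T : Type) (S : set (T -> T)) : (T -> T) -> Prop :=
| gen_in g : S g -> generated S g
| gen_id : generated S id
| gen_comp g h : generated S g -> generated S h -> generated S (g \o h)
| gen_inv g h : generated S g -> cancel g h -> cancel h g -> generated S h.

Section FlatKleinBottle.
Variable R : realType.

Definition plane : Type := (R * R)%type.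

Implicit Types (p q v : plane) (s t r : R).

(* The norm that the library puts on R * R is the sup norm. *)
Definition euclid_norm v : R := Num.sqrt (v.1 ^+ 2 + v.2 ^+ 2).

Definition line p v s : plane := (p.1 + s * v.1, p.2 + s * v.2).

Variables a b : R.

Definition glide p : plane := (p.1 + a, - p.2).
Definition shift p : plane := (p.1, p.2 + b).

Definition deck_group : set (plane -> plane) :=
  generated [set glide; shift].

Definition deck_orbit : rel plane :=
  fun p q => `[< exists2 g, deck_group g & g p = q >].

Lemma deck_group_affine g : deck_group g ->
  exists (e : bool) (c d : R),
    forall p, g p = (p.1 + c, (-1) ^+ e * p.2 + d).
Proof.
elim=> {g} [g [->|->]| |g h _ [e [c [d Hg]]] _ [e' [c' [d' Hh]]]
           |g h _ [e [c [d Hg]]] gK hK].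
- by exists true, a, 0 => p; rewrite /glide expr1 mulN1r addr0.
- by exists false, 0, b => p; rewrite /shift expr0 mul1r addr0.
- by exists false, 0, 0 => -[x y]; rewrite expr0 mul1r !addr0.
- exists (e (+) e'), (c' + c), ((-1) ^+ e * d' + d) => p /=.
  by rewrite Hg Hh /= addrA signr_addb mulrDr mulrA addrA.
- exists e, (- c), (- ((-1) ^+ e * d)) => p.
  rewrite -{2 3}(hK p) Hg /= addrK mulrDr mulrA -signr_addb addbb mul1r.
  by rewrite addrK; case: (h p).
Qed.

Lemma deck_orbit_equiv : equiv_class_of deck_orbit.
Proof.
have sym p q : deck_orbit p q -> deck_orbit q p.
  move=> /asboolP [g Gg <-]; apply/asboolP.
  have [e [c [d Hg]]] := deck_group_affine Gg.
  pose h q' : plane := (q'.1 - c, (-1) ^+ e * (q'.2 - d)).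
  have gK : cancel g h.
    by case=> x y; rewrite Hg /h /= !addrK mulrA -signr_addb addbb mul1r.
  have hK : cancel h g.
    case=> x y; rewrite Hg /h /= subrK mulrA -signr_addb addbb mul1r.
    by rewrite subrK.
  by exists h => //; exact: gen_inv Gg gK hK.
split.
- by move=> p; apply/asboolP; exists id => //; exact: gen_id.
- by move=> p q; apply/idP/idP; exact: sym.
- move=> q p z /asboolP [g Gg <-] /asboolP [h Gh <-]; apply/asboolP.
  by exists (h \o g) => //; exact: gen_comp.
Qed.

Canonical deck_orbit_equiv_rel := EquivRelPack deck_orbit_equiv.

(* The flat Klein bottle is R^2 / deck_group, for 0 < a and 0 < b. *)
Definition klein_bottle := {eq_quot deck_orbit}.

Implicit Types P Q : klein_bottle.

(* The lift repr P of P identifies the tangent space at P, with its inner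
   product, with the Euclidean plane; geodesics are the images of straight
   lines. The restriction of geodesic P v to [0, 1] has length
   euclid_norm v. *)
Definition geodesic P v s : klein_bottle :=
  \pi_klein_bottle (line (repr P) v s).

Definition exp_map P v : klein_bottle := geodesic P v 1.

Definition tangent_sphere t : set plane := [set v | euclid_norm v = t].

Definition wave_front P t : set klein_bottle :=
  exp_map P @` tangent_sphere t.

Definition geodesic_ball Q r : set klein_bottle :=
  [set Q' | exists2 v, euclid_norm v < r & geodesic Q v 1 = Q'].

Lemma pi_line p q v s : \pi_klein_bottle p = \pi_klein_bottle q ->
  exists2 w, euclid_norm w = euclid_norm v
           & \pi_klein_bottle (line p v s) = \pi_klein_bottle (line q w s).
Proof.
move=> /eqmodP /asboolP [g Gg <-].
have [e [c [d Hg]]] := deck_group_affine Gg.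
exists (v.1, (-1) ^+ e * v.2).
  by rewrite /euclid_norm /= exprMn sqrr_sign mul1r.
apply/eqmodP/asboolP; exists g => //.
rewrite !Hg /line /=; congr pair; ring.
Qed.

(* Wave fronts and balls do not depend on the lift chosen by repr. *)
Lemma wave_frontE P p t : \pi_klein_bottle p = P ->
  wave_front P t = [set \pi_klein_bottle (line p v 1) | v in tangent_sphere t].
Proof.
rewrite -{1}[P]reprK => Pp.
apply/seteqP; split=> _ [v vt <-].
- have [w wv ww] := pi_line v 1 (esym Pp).
  by exists w; rewrite // /tangent_sphere /= wv.
- have [w wv ww] := pi_line v 1 Pp.
  by exists w; rewrite // /tangent_sphere /= wv.
Qed.

Lemma geodesic_ballE Q q r : \pi_klein_bottle q = Q ->
  geodesic_ball Q r =
  [set \pi_klein_bottle (line q v 1) | v in [set v | euclid_norm v < r]].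
Proof.
rewrite -{1}[Q]reprK => Qq.
apply/seteqP; split=> _ [v vr <-].
- by have [w wv ww] := pi_line v 1 (esym Qq); exists w; rewrite /= ?wv.
- by have [w wv ww] := pi_line v 1 Qq; exists w; rewrite /= ?wv.
Qed.

End FlatKleinBottle.

(* Main.v *)
(** Near its topmost point, a circle of radius [t] lies at height between
    [t - b] and [t] over an interval of length of order [sqrt (b t)], where its
    slope is of order [sqrt (b / t)].  Some row of the lattice of translations
    [(2 a m, b n)], moved to the orbit of [Q], has its height in that range, and
    some point of that row is within [2 a] of the circle horizontally, hence
    within [O (1 / sqrt t)] vertically. *)
Require Import Defs.
From mathcomp Require Import all_boot all_order all_algebra.
From mathcomp Require Import boolp classical_sets reals.
From mathcomp Require Import ring lra.

Set Implicit Arguments.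
Unset Strict Implicit.
Unset Printing Implicit Defensive.

Import Order.TTheory GRing.Theory Num.Theory.
Local Open Scope classical_set_scope.
Local Open Scope ring_scope.
Local Open Scope quotient_scope.

Lemma arith_prog_itv (R : realType) (s c d : R) : 0 < s ->
  exists z : int, c - s < d + z%:~R * s <= c.
Proof.
move=> s0; pose z := Num.floor ((c - d) / s); exists z.
have /andP[] := floor_itv ((c - d) / s); rewrite -/z.
by rewrite intrD ler_pdivlMr // ltr_pdivrMr // mulrDl mul1r => ? ?; lra.
Qed.

Section Translations.
Variables (R : realType) (a b : R).

Definition translate (c d : R) (p : plane R) : plane R := (p.1 + c, p.2 + d).

Lemma deck_group_translate_nat (c d : R) (n : nat) :
  deck_group a b (translate c d) ->
  deck_group a b (translate (n%:R * c) (n%:R * d)).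
Proof.
move=> G; elim: n => [|n IHn].
  suff -> : translate (0%:R * c) (0%:R * d) = id by exact: gen_id.
  by apply/funext => -[x y]; rewrite /translate !mul0r !addr0.
suff -> : translate (n.+1%:R * c) (n.+1%:R * d) =
    translate c d \o translate (n%:R * c) (n%:R * d) by exact: gen_comp.
by apply/funext => -[x y]; rewrite /translate /= -natr1; congr pair; ring.
Qed.

Lemma deck_group_translate_int (c d : R) (m : int) :
  deck_group a b (translate c d) ->
  deck_group a b (translate (m%:~R * c) (m%:~R * d)).
Proof.
case: m => n G; first by rewrite -pmulrn; exact: deck_group_translate_nat.
apply: gen_inv (deck_group_translate_nat n.+1 G) _ _ => -[x y];
  by rewrite /translate /= NegzE mulrNz -pmulrn; congr pair; ring.
Qed.

(** The square of the glide reflection is a pure translation, so the deck group contains the lattice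
    of the covering torus. *)
Lemma deck_group_translate (m n : int) :
  deck_group a b (translate (m%:~R * (2 * a)) (n%:~R * b)).
Proof.
have Gh : deck_group a b (translate (2 * a) 0).
  suff -> : translate (2 * a) 0 = glide a \o glide a.
    by apply: gen_comp; apply: gen_in; left.
  by apply/funext => -[x y]; rewrite /translate /glide /=; congr pair; ring.
have Gv : deck_group a b (translate 0 b).
  suff -> : translate 0 b = shift b by apply: gen_in; right.
  by apply/funext => -[x y]; rewrite /translate /shift /= addr0.
suff -> : translate (m%:~R * (2 * a)) (n%:~R * b) =
    translate (m%:~R * (2 * a)) (m%:~R * 0) \o
    translate (n%:~R * 0) (n%:~R * b).
  by apply: gen_comp; exact: deck_group_translate_int.
by apply/funext => -[x y]; rewrite /translate /=; congr pair; ring.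
Qed.

Lemma pi_translate (m n : int) (q : plane R) :
  \pi_(klein_bottle a b) (translate (m%:~R * (2 * a)) (n%:~R * b) q) =
  \pi_(klein_bottle a b) q.
Proof.
apply/esym/eqmodP/asboolP.
by exists (translate (m%:~R * (2 * a)) (n%:~R * b)) => //;
  exact: deck_group_translate.
Qed.

End Translations.

(** Here [(x0, y0)] stands for a lift of $Q$ relative to a lift of $P$; [tau] is fixed before it,
    which makes the time uniform in $Q$. *)
Lemma circle_near_lattice (R : realType) (a b r : R) :
  0 < a -> 0 < b -> 0 < r ->
  exists tau : R, forall t, tau < t -> forall x0 y0 : R,
  exists m n : int,
  exists2 y : R, (x0 + m%:~R * (2 * a)) ^+ 2 + y ^+ 2 = t ^+ 2
    & `|y - (y0 + n%:~R * b)| < r.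
Proof.
move=> a0 b0 r0.
(* The four summands yield [ta], [tb], [tr1] and [tr2] in turn. The last two make [4 * a ^+ 2] and
   [4 * a * X] each less than a quarter of [t * r]. *)
exists (2 * a + 2 * b + 16 * a ^+ 2 / r + 512 * a ^+ 2 * b / r ^+ 2) => t ht.
have a2 : 0 < 16 * a ^+ 2 / r by rewrite divr_gt0 // mulr_gt0 // exprn_gt0.
have a2b : 0 < 512 * a ^+ 2 * b / r ^+ 2.
  by rewrite divr_gt0 ?exprn_gt0 // !mulr_gt0 // exprn_gt0.
have ta : 2 * a < t by lra.
have tb : 2 * b < t by lra.
have tr1 : 16 * a ^+ 2 < t * r by rewrite -ltr_pdivrMr //; lra.
have tr2 : 512 * a ^+ 2 * b < t * r ^+ 2.
  by rewrite -ltr_pdivrMr ?exprn_gt0 //; lra.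
have {ht a2 a2b} t0 : 0 < t by lra.
move=> x0 y0.
have [n /andP[yl yu]] := arith_prog_itv t y0 b0.
set y := y0 + _ in yl yu.
(* The circle meets the row of height [y] at abscissa [X]; the lattice point is then sought just to
   the left of [(X, y)]. *)
pose X := Num.sqrt (t ^+ 2 - y ^+ 2).
have X0 : 0 <= X by exact: sqrtr_ge0.
have XE : X ^+ 2 = t ^+ 2 - y ^+ 2 by rewrite sqr_sqrtr //; nra.
have Xu : X ^+ 2 <= 2 * b * t by rewrite XE; nra.
have Xt : X <= t by rewrite -(@ler_pXn2r _ 2) // ?nnegrE ?XE; nra.
(* Compare squares: [X ^+ 2] grows only linearly in [t]. *)
have XaR : 16 * a * X < t * r.
  rewrite -(@ltr_pXn2r _ 2) // ?nnegrE; try by rewrite !mulr_ge0 // ltW.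
  rewrite !exprMn.
  apply: (@le_lt_trans _ _ (t * (512 * a ^+ 2 * b))); last first.
    have -> : t ^+ 2 * r ^+ 2 = t * (t * r ^+ 2) by ring.
    by rewrite ltr_pM2l.
  have := ler_wpM2l (sqr_ge0 (16 * a)) Xu; rewrite exprMn; lra.
have a20 : 0 < 2 * a by lra.
have [m /andP[xl xu]] := arith_prog_itv X x0 a20.
set x := x0 + _ in xl xu.
pose Y := Num.sqrt (t ^+ 2 - x ^+ 2).
have Y0 : 0 <= Y by exact: sqrtr_ge0.
(* [x] may be negative, but [- t < - (2 * a) < x <= X <= t], so the radicand is nonnegative. *)
have YE : Y ^+ 2 = t ^+ 2 - x ^+ 2 by rewrite sqr_sqrtr //; nra.
exists m, n, Y; rewrite -/x -/y; first by rewrite YE; ring.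
have Yy0 : t / 2 < Y + y by lra.
(* [(X, y)] and [(x, Y)] lie on the same circle. Dividing by [Y + y], which exceeds [t / 2], bounds
   the vertical gap. *)
have Yy : (Y - y) * (Y + y) = (X - x) * (X + x).
  have -> : (Y - y) * (Y + y) = Y ^+ 2 - y ^+ 2 by ring.
  have -> : (X - x) * (X + x) = X ^+ 2 - x ^+ 2 by ring.
  rewrite YE XE; ring.
have Yy_gt0 : 0 < Y + y by lra.
have rYy : r * (t / 2) < r * (Y + y) by rewrite ltr_pM2l.
rewrite -(ltr_pM2r Yy_gt0) -{1}(gtr0_norm Yy_gt0) -normrM Yy normrM.
apply: le_lt_trans rYy.
have h1 : `|X - x| <= 2 * a by rewrite ler_norml; lra.
have h2 : `|X + x| <= 2 * X + 2 * a by rewrite ler_norml; lra.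
apply: le_trans (ler_pM (normr_ge0 _) (normr_ge0 _) h1 h2) _; lra.
Qed.

Theorem theorem2 (R : realType) (a b : R) (a_gt0 : 0 < a) (b_gt0 : 0 < b)
    (P : klein_bottle a b) (r : R) (r_gt0 : 0 < r) :
  exists tau : R, forall t : R, tau < t -> forall Q : klein_bottle a b,
    wave_front P t `&` geodesic_ball Q r !=set0.
Proof.
have [tau near_lattice] := circle_near_lattice a_gt0 b_gt0 r_gt0.
(* The maximum forces [0 < t], so that the square root of [t ^+ 2] is [t]. *)
exists (Num.max tau 0) => t; rewrite gt_max => /andP[/near_lattice{}H t0] Q.
pose p := repr P; pose q := repr Q.
have [m [n [y xyt yr]]] := H (q.1 - p.1) (q.2 - p.2).
set x := q.1 - p.1 + _ in xyt; set y' := q.2 - p.2 + _ in yr.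
pose q' := translate (m%:~R * (2 * a)) (n%:~R * b) q.
have piq' : \pi_(klein_bottle a b) q' = Q by rewrite pi_translate reprK.
exists (\pi_(klein_bottle a b) (line p (x, y) 1)); split.
  by exists (x, y); rewrite //= /tangent_sphere /= /euclid_norm /= xyt
    sqrtr_sqr gtr0_norm.
(* The point of the front has the same abscissa as the lift [q'] of [Q], so a vertical segment joins
   them. *)
rewrite (geodesic_ballE r piq'); exists (0, y - y').
  by rewrite /= /euclid_norm /= expr0n /= add0r sqrtr_sqr.
congr \pi; rewrite /line /q' /translate /x /y' /=; congr pair; ring.
Qed.
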